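(* Let $\Bbbk$ be a field, $A$ a finite-dimensional $\Bbbk$-algebra, and $G$ a finite abelian group acting on $A$ via ($\Bbbk$-algebra) automorphisms. Let $A^G=\{a\in A\mid g(a)=a\ \ \forall g\in G\}$ be the subalgebra of $G$-invariants. (i) If $\mathrm{char}(\Bbbk)$ does not divide the order of $G$, then $A\leq_J A^G$. (ii) If $A$ is basic and the action of $G$ is such that the induced action on the underlying quiver of $A$ is free, then $A^G\leq_J A$. (iii) Assume that $A$ is basic, that $\mathrm{char}(\Bbbk)\nmid |G|$, that the action of $G$ on the underlying quiver of $A$ is free, that $A^G$ is symmetric, and that $\mathrm{Hom}_\Bbbk(A,\Bbbk)\simeq {}_AA^{g}_A$ as $A$-$A$-bimodules for some $g\in G$. Then $A$ and $A^G$ are symmetrically separably equivalent.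
   Context: All algebras are finite-dimensional, associative, unital $\Bbbk$-algebras, and all (bi)modules are finite-dimensional. For $\Bbbk$-algebras $A,B$ one writes $A\geq_J B$ (equivalently $B\leq_J A$) if there are bimodules ${}_AM_B$ and ${}_BN_A$ such that $M\otimes_B N\simeq A\oplus X$ as $A$-$A$-bimodules for some $A$-$A$-bimodule $X$. A bimodule ${}_AM_B$ is left-right projective if ${}_AM$ is a projective left $A$-module and $M_B$ is a projective right $B$-module. Algebras $A$ and $B$ are symmetrically separably equivalent if there are left-right projective bimodules ${}_AM_B$ and ${}_BN_A$ such that $A$ is a direct summand of $M\otimes_B N$ as $A$-$A$-bimodule, $B$ is a direct summand of $N\otimes_A M$ as $B$-$B$-bimodule, and the functors $M\otimes_B-:B\text{-mod}\to A\text{-mod}$ and $N\otimes_A-:A\text{-mod}\to B\text{-mod}$ are biadjoint (each is both left and right adjoint to the other). An algebra $C$ is symmetric if $C\simeq \mathrm{Hom}_\Bbbk(C,\Bbbk)$ as $C$-$C$-bimodules. For $g\in G$, ${}_AA^g_A$ denotes the regular $A$-$A$-bimodule with right action twisted by $g$, i.e. $x\cdot a = x\,g(a)$. For the statements about the quiver: $A=\Bbbk Q/I$ is the path algebra of a finite quiver $Q$ (the underlying quiver of $A$) modulo an admissible ideal, and the action of $G$ on $A$ permutes the vertices (vertex idempotents) and the arrows of $Q$; the action on $Q$ is free if no non-identity element of $G$ fixes a vertex (hence none fixes an arrow). *)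

(* Defs.v *)
From HB Require Import structures.
From mathcomp Require Import all_boot all_order all_algebra all_fingroup all_field.
From mathcomp Require Import finmap boolp.
From mathcomp.multinomials Require Import monalg.

Set Implicit Arguments.
Unset Strict Implicit.
Unset Printing Implicit Defensive.

Import GRing.Theory VectorInternalTheory.
Local Open Scope ring_scope.

Section LinearHelpers.
Variable k : fieldType.

Lemma linfunE (U V : vectType k) (f : U -> V) : linear f -> linfun f =1 f.
Proof.
move=> fL x.
pose g : {linear U -> V} := HB.pack f (GRing.isLinear.Build k U V _ f fL).
exact: (lfunE g).
Qed.

Definition bilinfun (U V W : vectType k) (f : U -> V -> W) :
  'Hom(U, 'Hom(V, W)) := linfun (fun u => linfun (f u)).

Lemma bilinfunE (U V W : vectType k) (f : U -> V -> W) :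
    (forall u, linear (f u)) -> (forall v, linear (f^~ v)) ->
  forall u v, bilinfun f u v = f u v.
Proof.
move=> fr fl u v; rewrite /bilinfun linfunE ?linfunE // => c x y.
by apply/lfunP=> z; rewrite !lfunE /= !lfunE /= !(linfunE (fr _)) fl.
Qed.

(* A model of V / U: the fixed complement U^C, onto which V is projected
   along U. *)
Definition quotv (V : vectType k) (U : {vspace V}) : vectType k :=
  subvs_of (U^C)%VS.

Definition quotv_pi (V : vectType k) (U : {vspace V}) : 'Hom(V, quotv U) :=
  linfun (fun v => vsproj (U^C)%VS (daddv_pi (U^C) U v)).

Lemma quotv_piE (V : vectType k) (U : {vspace V}) v :
  vsval (quotv_pi U v) = daddv_pi (U^C) U v.
Proof.
rewrite /quotv_pi linfunE; first by rewrite vsprojK // memv_pi.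
by move=> c x y; rewrite !linearP.
Qed.

Lemma quotv_pi_val (V : vectType k) (U : {vspace V}) (x : quotv U) :
  quotv_pi U (vsval x) = x.
Proof.
apply: val_inj; rewrite /= quotv_piE daddv_pi_id ?subvsP //.
by rewrite capvC capv_compl.
Qed.

Lemma lker_quotv_pi (V : vectType k) (U : {vspace V}) : lker (quotv_pi U) = U.
Proof.
have capUC : (U^C :&: U = 0)%VS by rewrite capvC capv_compl.
have defV v : daddv_pi (U^C) U v + daddv_pi U (U^C) v = v.
  by apply: daddv_pi_add => //; rewrite addvC addv_complf memvf.
apply/vspaceP=> v; rewrite memv_ker; apply/eqP/idP => [piv0|Uv].
  rewrite -(defV v) -quotv_piE piv0 linear0 add0r; exact: memv_pi.
apply: val_inj; rewrite /= quotv_piE.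
have := defV v; rewrite (daddv_pi_id (capv_compl U) Uv) => /(canRL (addrK v)).
by rewrite subrr.
Qed.

Lemma quotv_pi_sub (V : vectType k) (U : {vspace V}) v :
  vsval (quotv_pi U v) - v \in U.
Proof.
suff : vsval (quotv_pi U v) - v \in lker (quotv_pi U).
  by rewrite lker_quotv_pi.
by rewrite memv_ker linearB /= quotv_pi_val subrr.
Qed.

End LinearHelpers.

Section Modules.
Variable k : fieldType.

Record lmodule (A : falgType k) := LModule {
  lm_car :> vectType k;
  lm_act : 'Hom(A, 'End(lm_car));
  lm_act1 : forall x, lm_act 1 x = x;
  lm_actM : forall a b x, lm_act (a * b) x = lm_act a (lm_act b x) }.

Record rmodule (A : falgType k) := RModule {
  rm_car :> vectType k;
  rm_act : 'Hom(A, 'End(rm_car));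
  rm_act1 : forall x, rm_act 1 x = x;
  rm_actM : forall a b x, rm_act (a * b) x = rm_act b (rm_act a x) }.

(* Both actions are k-linear in the algebra variable, so k acts centrally. *)
Record bimodule (A B : falgType k) := BiModule {
  bm_car :> vectType k;
  bm_lact : 'Hom(A, 'End(bm_car));
  bm_ract : 'Hom(B, 'End(bm_car));
  bm_lact1 : forall x, bm_lact 1 x = x;
  bm_lactM : forall a b x, bm_lact (a * b) x = bm_lact a (bm_lact b x);
  bm_ract1 : forall x, bm_ract 1 x = x;
  bm_ractM : forall a b x, bm_ract (a * b) x = bm_ract b (bm_ract a x);
  bm_actC : forall a b x, bm_lact a (bm_ract b x) = bm_ract b (bm_lact a x) }.

Definition bm_left (A B : falgType k) (M : bimodule A B) : lmodule A :=
  LModule (@bm_lact1 _ _ M) (@bm_lactM _ _ M).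

Definition bm_right (A B : falgType k) (M : bimodule A B) : rmodule B :=
  RModule (@bm_ract1 _ _ M) (@bm_ractM _ _ M).

Definition is_lmod_hom (A : falgType k) (M N : lmodule A) (f : 'Hom(M, N)) :=
  forall a x, f (lm_act M a x) = lm_act N a (f x).

Definition is_rmod_hom (A : falgType k) (M N : rmodule A) (f : 'Hom(M, N)) :=
  forall a x, f (rm_act M a x) = rm_act N a (f x).

Definition is_bimod_hom (A B : falgType k) (M N : bimodule A B)
    (f : 'Hom(M, N)) :=
  (forall a x, f (bm_lact M a x) = bm_lact N a (f x)) /\
  (forall b x, f (bm_ract M b x) = bm_ract N b (f x)).

Definition bimod_iso (A B : falgType k) (M N : bimodule A B) : Prop :=
  exists f : 'Hom(M, N), is_bimod_hom f /\ bijective f.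

Section RegularAndDual.
Variable A : falgType k.

Fact mul_linr (a : A) : linear (fun x : A => a * x).
Proof. by move=> c x y; rewrite mulrDr scalerAr. Qed.
Fact mul_linl (x : A) : linear (fun a : A => a * x).
Proof. by move=> c a b; rewrite mulrDl scalerAl. Qed.

Definition lmul : 'Hom(A, 'End(A)) := bilinfun (fun a x : A => a * x).
Definition rmul : 'Hom(A, 'End(A)) := bilinfun (fun a x : A => x * a).

Lemma lmulE a x : lmul a x = a * x.
Proof. by rewrite /lmul (bilinfunE mul_linr mul_linl). Qed.
Lemma rmulE a x : rmul a x = x * a.
Proof. by rewrite /rmul (bilinfunE mul_linl mul_linr). Qed.

Fact lmul1 x : lmul 1 x = x. Proof. by rewrite lmulE mul1r. Qed.
Fact lmulM a b x : lmul (a * b) x = lmul a (lmul b x).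
Proof. by rewrite !lmulE mulrA. Qed.
Fact rmul1 x : rmul 1 x = x. Proof. by rewrite rmulE mulr1. Qed.
Fact rmulM a b x : rmul (a * b) x = rmul b (rmul a x).
Proof. by rewrite !rmulE mulrA. Qed.
Fact lrmulC a b x : lmul a (rmul b x) = rmul b (lmul a x).
Proof. by rewrite !(lmulE, rmulE) mulrA. Qed.

Definition regular_bimod : bimodule A A :=
  BiModule lmul1 lmulM rmul1 rmulM lrmulC.

Definition dual_lact : 'Hom(A, 'End('Hom(A, k^o))) :=
  bilinfun (fun a (f : 'Hom(A, k^o)) => (f \o rmul a)%VF).
Definition dual_ract : 'Hom(A, 'End('Hom(A, k^o))) :=
  bilinfun (fun b (f : 'Hom(A, k^o)) => (f \o lmul b)%VF).

Lemma dual_lactE a f x : dual_lact a f x = f (x * a).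
Proof.
rewrite /dual_lact bilinfunE => [|{}a c f1 f2|{}f c a1 a2].
- by rewrite comp_lfunE rmulE.
- by apply/lfunP=> y; rewrite !(comp_lfunE, add_lfunE, scale_lfunE).
- apply/lfunP=> y; rewrite !(comp_lfunE, add_lfunE, scale_lfunE, rmulE).
  by rewrite mul_linr linearP.
Qed.

Lemma dual_ractE b f x : dual_ract b f x = f (b * x).
Proof.
rewrite /dual_ract bilinfunE => [|{}b c f1 f2|{}f c b1 b2].
- by rewrite comp_lfunE lmulE.
- by apply/lfunP=> y; rewrite !(comp_lfunE, add_lfunE, scale_lfunE).
- apply/lfunP=> y; rewrite !(comp_lfunE, add_lfunE, scale_lfunE, lmulE).
  by rewrite mul_linl linearP.
Qed.

Fact dual_lact1 f : dual_lact 1 f = f.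
Proof. by apply/lfunP=> x; rewrite dual_lactE mulr1. Qed.
Fact dual_lactM a b f : dual_lact (a * b) f = dual_lact a (dual_lact b f).
Proof. by apply/lfunP=> x; rewrite !dual_lactE mulrA. Qed.
Fact dual_ract1 f : dual_ract 1 f = f.
Proof. by apply/lfunP=> x; rewrite dual_ractE mul1r. Qed.
Fact dual_ractM a b f : dual_ract (a * b) f = dual_ract b (dual_ract a f).
Proof. by apply/lfunP=> x; rewrite !dual_ractE mulrA. Qed.
Fact dual_actC a b f :
  dual_lact a (dual_ract b f) = dual_ract b (dual_lact a f).
Proof.
by apply/lfunP=> x; rewrite !(dual_lactE, dual_ractE) mulrA.
Qed.

(* Hom_k(A, k) with (a . f . b)(x) = f (b x a). *)
Definition dual_bimod : bimodule A A :=
  BiModule dual_lact1 dual_lactM dual_ract1 dual_ractM dual_actC.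

Definition symmetric_algebra : Prop := bimod_iso regular_bimod dual_bimod.

End RegularAndDual.

Section DirectSum.
Variables (A B : falgType k) (M N : bimodule A B).

Definition dsum_lact : 'Hom(A, 'End((M * N)%type)) :=
  bilinfun (fun a (z : M * N) => (bm_lact M a z.1, bm_lact N a z.2)).
Definition dsum_ract : 'Hom(B, 'End((M * N)%type)) :=
  bilinfun (fun b (z : M * N) => (bm_ract M b z.1, bm_ract N b z.2)).

Lemma dsum_lactE a z : dsum_lact a z = (bm_lact M a z.1, bm_lact N a z.2).
Proof.
rewrite /dsum_lact bilinfunE // => [{}a c z1 z2|{}z c a1 a2].
  by rewrite !linearP.
by rewrite !linearP /= !lfunE /= !lfunE.
Qed.
Lemma dsum_ractE b z : dsum_ract b z = (bm_ract M b z.1, bm_ract N b z.2).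
Proof.
rewrite /dsum_ract bilinfunE // => [{}b c z1 z2|{}z c b1 b2].
  by rewrite !linearP.
by rewrite !linearP /= !lfunE /= !lfunE.
Qed.

Fact dsum_lact1 z : dsum_lact 1 z = z.
Proof. by rewrite dsum_lactE !bm_lact1; case: z. Qed.
Fact dsum_lactM a b z : dsum_lact (a * b) z = dsum_lact a (dsum_lact b z).
Proof. by rewrite !dsum_lactE !bm_lactM. Qed.
Fact dsum_ract1 z : dsum_ract 1 z = z.
Proof. by rewrite dsum_ractE !bm_ract1; case: z. Qed.
Fact dsum_ractM a b z : dsum_ract (a * b) z = dsum_ract b (dsum_ract a z).
Proof. by rewrite !dsum_ractE !bm_ractM. Qed.
Fact dsum_actC a b z :
  dsum_lact a (dsum_ract b z) = dsum_ract b (dsum_lact a z).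
Proof. by rewrite !(dsum_lactE, dsum_ractE) !bm_actC. Qed.

Definition dsum_bimod : bimodule A B :=
  BiModule dsum_lact1 dsum_lactM dsum_ract1 dsum_ractM dsum_actC.

End DirectSum.

Section TensorOverField.
Variables M N : vectType k.

(* M (x)_k N, modelled by matrices in the coordinates of M and N; a pure tensor
   is the outer product of the coordinate vectors. *)
Definition ktensor : vectType k := 'M[k]_(dim M, dim N).
Definition kpure (x : M) (y : N) : ktensor := (v2r x)^T *m v2r y.

Fact kpure_linr x : linear (kpure x).
Proof. by move=> c y1 y2; rewrite /kpure linearP mulmxDr -scalemxAr. Qed.
Fact kpure_linl y : linear (kpure^~ y).
Proof.
by move=> c x1 x2; rewrite /kpure !linearP /= mulmxDl -scalemxAl.
Qed.

Lemma kpure_ext (W : vectType k) (f g : 'Hom(ktensor, W)) :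
  (forall x y, f (kpure x y) = g (kpure x y)) -> f = g.
Proof.
move=> eq_fg; apply/lfunP=> X.
rewrite [X]matrix_sum_delta !linear_sum; apply: eq_bigr => i _.
rewrite !linear_sum; apply: eq_bigr => j _; rewrite !linearZ /=.
suff ->: delta_mx i j = kpure (r2v (delta_mx 0 i)) (r2v (delta_mx 0 j)).
  by rewrite eq_fg.
by rewrite /kpure !r2vK trmx_delta mul_delta_mx.
Qed.

End TensorOverField.

Definition ktensor_map (M M' N N' : vectType k) (f : 'Hom(M, M'))
    (g : 'Hom(N, N')) : 'Hom(ktensor M N, ktensor M' N') :=
  linfun (fun X : 'M_(dim M, dim N) => ((f2mx f)^T *m X *m f2mx g)).

Lemma ktensor_mapE (M M' N N' : vectType k) (f : 'Hom(M, M'))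
  (g : 'Hom(N, N')) x y : ktensor_map f g (kpure x y) = kpure (f x) (g y).
Proof.
rewrite /ktensor_map linfunE => [|c X Y]; last first.
  by rewrite mulmxDr mulmxDl -scalemxAr -scalemxAl.
have lfun_mxE (V W : vectType k) (h : 'Hom(V, W)) v :
    h v = r2v (v2r v *m f2mx h) by rewrite unlock.
by rewrite /kpure !lfun_mxE !r2vK trmx_mul !mulmxA.
Qed.

Section Tensor.
Variables (B : falgType k) (M : rmodule B) (N : lmodule B).

(* The span of all x b (x) y - x (x) b y; by multilinearity (mem_tensor_rel) it
   is enough to let b, x and y range over bases. *)
Definition tensor_rel : {vspace (ktensor M N)} :=
  (\sum_(b <- vbasis {:B})
     <<[seq kpure (rm_act M b x) y - kpure x (lm_act N b y)
         | x <- vbasis {:M}, y <- vbasis {:N}]>>)%VS.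

Lemma mem_tensor_rel x b y :
  kpure (rm_act M b x) y - kpure x (lm_act N b y) \in tensor_rel.
Proof.
pose h b x y := kpure (rm_act M b x) y - kpure x (lm_act N b y).
have basisE (V : vectType k) (v : V) :
    v = \sum_(i < \dim {:V}) coord (vbasis {:V}) i v *: (vbasis {:V})`_i.
  by apply: coord_vbasis; exact: memvf.
have hb x' y' : linear (fun b => h b x' y').
  move=> c b1 b2; rewrite /h !linearP /= !lfunE /= !lfunE /=.
  by rewrite kpure_linl kpure_linr scalerBr opprD addrACA.
have hx b' y' : linear (fun x => h b' x y').
  by move=> c x1 x2; rewrite /h linearP !kpure_linl scalerBr opprD addrACA.
have hy b' x' : linear (fun y => h b' x' y).
  by move=> c y1 y2; rewrite /h linearP !kpure_linr scalerBr opprD addrACA.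
have lin_sum (V W : vectType k) (f : V -> W) (U : {vspace W}) : linear f ->
    (forall v, v \in vbasis {:V} -> f v \in U) -> forall v, f v \in U.
  move=> fL fU v; rewrite -(linfunE fL) [v]basisE linear_sum.
  apply: memv_suml => i _; rewrite linearZ /= memvZ // linfunE //.
  by apply: fU; apply: memt_nth.
rewrite -/(h b x y); apply: (lin_sum _ _ (fun b => h b x y)) => // {}b bB.
apply: (lin_sum _ _ (fun x => h b x y)) => // {}x xB.
apply: (lin_sum _ _ (fun y => h b x y)) => // {}y yB.
rewrite /tensor_rel (big_rem b) //=; apply: (subvP (addvSl _ _)).
by apply: memv_span; apply/allpairsP; exists (x, y).
Qed.

Lemma tensor_rel_sub (U : {vspace (ktensor M N)}) :
  (forall x b y, kpure (rm_act M b x) y - kpure x (lm_act N b y) \in U) ->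
  (tensor_rel <= U)%VS.
Proof.
move=> genU; rewrite /tensor_rel; elim/big_rec: _ => [|b V _ VU].
  exact: sub0v.
rewrite subv_add VU andbT; apply/span_subvP => _ /allpairsP[[x y] [_ _ ->]].
exact: genU.
Qed.

Definition tensor : vectType k := quotv tensor_rel.
Definition tens (x : M) (y : N) : tensor := quotv_pi tensor_rel (kpure x y).

Lemma tens_linr x : linear (tens x).
Proof. by move=> c y1 y2; rewrite /tens kpure_linr linearP. Qed.
Lemma tens_linl y : linear (tens^~ y).
Proof. by move=> c x1 x2; rewrite /tens kpure_linl linearP. Qed.

Lemma tensA x b y : tens (rm_act M b x) y = tens x (lm_act N b y).
Proof.
apply/eqP; rewrite -subr_eq0 /tens -linearB -memv_ker lker_quotv_pi.
exact: mem_tensor_rel.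
Qed.

Lemma tensor_ext (W : vectType k) (f g : 'Hom(tensor, W)) :
  (forall x y, f (tens x y) = g (tens x y)) -> f = g.
Proof.
move=> eq_fg; apply/lfunP=> z; rewrite -[z]quotv_pi_val.
rewrite -!(comp_lfunE _ (quotv_pi _)); congr (fun_of_lfun _ _).
by apply: kpure_ext => x y; rewrite !comp_lfunE eq_fg.
Qed.

(* The universal property, which pins the construction down. *)
Lemma tensor_universal (W : vectType k) (h : M -> N -> W) :
    (forall x, linear (h x)) -> (forall y, linear (h^~ y)) ->
    (forall x b y, h (rm_act M b x) y = h x (lm_act N b y)) ->
  exists! f : 'Hom(tensor, W), forall x y, f (tens x y) = h x y.
Proof.
move=> hr hl hA.
pose F (X : ktensor M N) : W :=
  \sum_i \sum_j X i j *: h (r2v (delta_mx 0 i)) (r2v (delta_mx 0 j)).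
have FL : linear F.
  move=> c X Y; rewrite /F scaler_sumr -big_split; apply: eq_bigr => i _ /=.
  rewrite scaler_sumr -big_split; apply: eq_bigr => j _ /=.
  by rewrite !mxE scalerDl scalerA.
have deltaE (V : vectType k) (v : V) : \sum_i v2r v 0 i *: r2v (delta_mx 0 i) = v.
  rewrite -[RHS]v2rK [v2r v in RHS]row_sum_delta linear_sum.
  by apply: eq_bigr => i _; rewrite linearZ.
have FE x y : F (kpure x y) = h x y.
  rewrite -[in RHS](deltaE _ x) -(linfunE (hl y)) linear_sum.
  apply: eq_bigr => i _; rewrite linearZ /= linfunE //.
  rewrite -[in RHS](deltaE _ y) -(linfunE (hr _)) linear_sum scaler_sumr.
  apply: eq_bigr => j _; rewrite linearZ /= linfunE // scalerA.
  by rewrite /kpure !mxE big_ord1 !mxE.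
pose f : 'Hom(tensor, W) := (linfun F \o linfun vsval)%VF.
have fE x y : f (tens x y) = h x y.
  rewrite /f comp_lfunE lfunE /= -FE -(linfunE FL); apply/eqP.
  rewrite -subr_eq0 -linearB -memv_ker.
  have /subvP : (tensor_rel <= lker (linfun F))%VS.
    apply: tensor_rel_sub => x' b y'.
    by rewrite memv_ker linearB /= !linfunE // !FE hA subrr.
  by apply; apply: quotv_pi_sub.
exists f; split => // g gE; apply: tensor_ext => x y.
by rewrite fE gE.
Qed.

End Tensor.

Section TensorMap.
Variable B : falgType k.

(* Meaningful when f and g are B-linear; see tensor_mapE. *)
Definition tensor_map (M M' : rmodule B) (N N' : lmodule B)
    (f : 'Hom(M, M')) (g : 'Hom(N, N')) : 'Hom(tensor M N, tensor M' N') :=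
  (quotv_pi (tensor_rel M' N') \o ktensor_map f g \o linfun vsval)%VF.

Lemma tensor_mapE (M M' : rmodule B) (N N' : lmodule B)
    (f : 'Hom(M, M')) (g : 'Hom(N, N')) :
    is_rmod_hom f -> is_lmod_hom g ->
  forall x y, tensor_map f g (tens x y) = tens (f x) (g y).
Proof.
move=> fB gB x y.
rewrite /tensor_map !comp_lfunE lfunE /= {2}/tens -ktensor_mapE; apply/eqP.
rewrite -subr_eq0 -linearB -memv_ker lker_quotv_pi -linearB /=.
set z := _ - _.
have zR : z \in tensor_rel M N by apply: quotv_pi_sub.
have /subvP/(_ z zR) :
    (tensor_rel M N <=
      lker (quotv_pi (tensor_rel M' N') \o ktensor_map f g))%VS.
  apply: tensor_rel_sub => x' b y'; rewrite memv_ker comp_lfunE.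
  rewrite linearB /= !ktensor_mapE fB gB -memv_ker lker_quotv_pi.
  exact: mem_tensor_rel.
by rewrite memv_ker comp_lfunE -memv_ker lker_quotv_pi.
Qed.

End TensorMap.

Fact is_rmod_hom_id (A : falgType k) (M : rmodule A) :
  is_rmod_hom (\1%VF : 'Hom(M, M)).
Proof. by move=> a x; rewrite !id_lfunE. Qed.

Fact is_lmod_hom_id (A : falgType k) (M : lmodule A) :
  is_lmod_hom (\1%VF : 'Hom(M, M)).
Proof. by move=> a x; rewrite !id_lfunE. Qed.

Fact bm_lact_rhom (A B : falgType k) (M : bimodule A B) a :
  is_rmod_hom (bm_lact M a : 'Hom(bm_right M, bm_right M)).
Proof. by move=> b x; rewrite /= bm_actC. Qed.

Fact bm_ract_lhom (A B : falgType k) (M : bimodule A B) b :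
  is_lmod_hom (bm_ract M b : 'Hom(bm_left M, bm_left M)).
Proof. by move=> a x; rewrite /= bm_actC. Qed.

Section TensorLeft.
Variables (A B : falgType k) (M : bimodule A B) (N : lmodule B).
Let T := tensor (bm_right M) N.

Definition tensor_lact : 'Hom(A, 'End(T)) :=
  linfun (fun a : A => tensor_map (M := bm_right M) (M' := bm_right M)
                        (bm_lact M a) (\1%VF : 'End(N))).

Lemma tensor_lactE a x y :
  tensor_lact a (tens (M := bm_right M) x y) =
    tens (M := bm_right M) (bm_lact M a x) y.
Proof.
have mE b := tensor_mapE (bm_lact_rhom (M := M) b) (@is_lmod_hom_id _ N).
rewrite /tensor_lact linfunE ?mE ?id_lfunE // => c a1 a2.
apply: tensor_ext => x' y'; rewrite add_lfunE scale_lfunE !mE id_lfunE.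
by rewrite linearP add_lfunE scale_lfunE tens_linl.
Qed.

Fact tensor_lact1 z : tensor_lact 1 z = z.
Proof.
rewrite -[RHS]id_lfunE; congr (fun_of_lfun _ z).
by apply: tensor_ext => x y; rewrite tensor_lactE bm_lact1 id_lfunE.
Qed.

Fact tensor_lactM a b z :
  tensor_lact (a * b) z = tensor_lact a (tensor_lact b z).
Proof.
rewrite -[RHS]comp_lfunE; congr (fun_of_lfun _ z).
by apply: tensor_ext => x y; rewrite comp_lfunE !tensor_lactE bm_lactM.
Qed.

Definition tensor_lmod : lmodule A := LModule tensor_lact1 tensor_lactM.

End TensorLeft.

Section TensorBimodule.
Variables (A B C : falgType k) (M : bimodule A B) (N : bimodule B C).
Let T := tensor (bm_right M) (bm_left N).

Definition tensor_ract : 'Hom(C, 'End(T)) :=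
  linfun (fun c : C => tensor_map (N := bm_left N) (N' := bm_left N)
                        (\1%VF : 'End(bm_right M)) (bm_ract N c)).

Lemma tensor_ractE c x y :
  tensor_ract c (tens (M := bm_right M) (N := bm_left N) x y) =
    tens (M := bm_right M) (N := bm_left N) x (bm_ract N c y).
Proof.
have mE b := tensor_mapE (@is_rmod_hom_id _ (bm_right M))
  (bm_ract_lhom (M := N) b).
rewrite /tensor_ract linfunE ?mE ?id_lfunE // => d a1 a2.
apply: tensor_ext => x' y'; rewrite add_lfunE scale_lfunE !mE id_lfunE.
by rewrite linearP add_lfunE scale_lfunE tens_linr.
Qed.

Fact tensor_ract1 z : tensor_ract 1 z = z.
Proof.
rewrite -[RHS]id_lfunE; congr (fun_of_lfun _ z).
by apply: tensor_ext => x y; rewrite tensor_ractE bm_ract1 id_lfunE.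
Qed.

Fact tensor_ractM a b z :
  tensor_ract (a * b) z = tensor_ract b (tensor_ract a z).
Proof.
rewrite -[RHS]comp_lfunE; congr (fun_of_lfun _ z).
by apply: tensor_ext => x y; rewrite comp_lfunE !tensor_ractE bm_ractM.
Qed.

Fact tensor_actC a c (z : T) :
  tensor_lact M (bm_left N) a (tensor_ract c z) =
    tensor_ract c (tensor_lact M (bm_left N) a z).
Proof.
rewrite -!comp_lfunE; congr (fun_of_lfun _ z).
apply: tensor_ext => x y.
by rewrite !comp_lfunE !(tensor_lactE, tensor_ractE).
Qed.

Definition tensor_bimod : bimodule A C :=
  BiModule (@tensor_lact1 _ _ M (bm_left N)) (@tensor_lactM _ _ M (bm_left N))
    tensor_ract1 tensor_ractM tensor_actC.

End TensorBimodule.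

Definition bimod_summand (A B : falgType k) (M N : bimodule A B) : Prop :=
  exists X : bimodule A B, bimod_iso N (dsum_bimod M X).

Definition J_ge (A B : falgType k) : Prop :=
  exists (M : bimodule A B) (N : bimodule B A),
    bimod_summand (regular_bimod A) (tensor_bimod M N).

Definition J_le (A B : falgType k) : Prop := J_ge B A.

Definition lprojective (A : falgType k) (P : lmodule A) : Prop :=
  forall (M N : lmodule A) (e : 'Hom(M, N)) (f : 'Hom(P, N)),
    is_lmod_hom e -> (forall y, exists x, e x = y) -> is_lmod_hom f ->
  exists g : 'Hom(P, M), is_lmod_hom g /\ (e \o g)%VF = f.

Definition rprojective (A : falgType k) (P : rmodule A) : Prop :=
  forall (M N : rmodule A) (e : 'Hom(M, N)) (f : 'Hom(P, N)),
    is_rmod_hom e -> (forall y, exists x, e x = y) -> is_rmod_hom f ->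
  exists g : 'Hom(P, M), is_rmod_hom g /\ (e \o g)%VF = f.

Definition lr_projective (A B : falgType k) (M : bimodule A B) : Prop :=
  lprojective (bm_left M) /\ rprojective (bm_right M).

Record lmod_hom (A : falgType k) (M N : lmodule A) := LModHom {
  lmod_fun :> 'Hom(M, N);
  lmod_funP : is_lmod_hom lmod_fun }.

Lemma lmod_hom_inj (A : falgType k) (M N : lmodule A) :
  injective (@lmod_fun A M N).
Proof.
move=> [f fP] [g gP] /= eq_fg; case: g / eq_fg gP => gP.
by congr LModHom; apply: Prop_irrelevance.
Qed.

Definition lmod_id (A : falgType k) (M : lmodule A) : lmod_hom M M :=
  LModHom (@is_lmod_hom_id A M).

Fact lmod_comp_subproof (A : falgType k) (L M N : lmodule A)
  (f : lmod_hom M N) (g : lmod_hom L M) : is_lmod_hom (f \o g)%VF.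
Proof. by move=> a x; rewrite !comp_lfunE !lmod_funP. Qed.

Definition lmod_comp (A : falgType k) (L M N : lmodule A)
  (f : lmod_hom M N) (g : lmod_hom L M) := LModHom (lmod_comp_subproof f g).

(* Functors A-mod -> B-mod. *)
Record mod_functor (A B : falgType k) := ModFunctor {
  fobj :> lmodule A -> lmodule B;
  fmap : forall V W, lmod_hom V W -> lmod_hom (fobj V) (fobj W);
  fmap_id : forall V, fmap (lmod_id V) = lmod_id (fobj V);
  fmap_comp : forall U V W (f : lmod_hom V W) (g : lmod_hom U V),
    fmap (lmod_comp f g) = lmod_comp (fmap f) (fmap g) }.

Definition left_adjoint (A B : falgType k)
    (F : mod_functor A B) (G : mod_functor B A) : Prop :=
  exists phi : forall V W, lmod_hom (F V) W -> lmod_hom V (G W),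
    (forall V W, bijective (phi V W)) /\
    (forall V V' W W' (u : lmod_hom V' V) (w : lmod_hom W W')
        (f : lmod_hom (F V) W),
      phi V' W' (lmod_comp w (lmod_comp f (fmap F u))) =
        lmod_comp (fmap G w) (lmod_comp (phi V W f) u)).

Definition biadjoint (A B : falgType k)
    (F : mod_functor A B) (G : mod_functor B A) : Prop :=
  left_adjoint F G /\ left_adjoint G F.

Section TensorFunctor.
Variables (A B : falgType k) (M : bimodule A B).

Lemma tensor_mapE1 (V W : lmodule B) (f : lmod_hom V W) x y :
  tensor_map (M := bm_right M) (M' := bm_right M) \1%VF f (tens x y) =
    tens (M := bm_right M) x (f y).
Proof.
have := tensor_mapE (@is_rmod_hom_id _ (bm_right M)) (lmod_funP f).
by move=> ->; rewrite id_lfunE.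
Qed.

Fact tensor_fmap_subproof (V W : lmodule B) (f : lmod_hom V W) :
  is_lmod_hom (tensor_map (M := bm_right M) (M' := bm_right M) \1%VF f
    : 'Hom(tensor_lmod M V, tensor_lmod M W)).
Proof.
move=> a z; have FE := tensor_mapE1 f; move: (tensor_map _ _) FE => F FE.
suff : (F \o tensor_lact M V a = tensor_lact M W a \o F)%VF.
  by move=> /lfunP/(_ z); rewrite !comp_lfunE.
by apply: tensor_ext => x y; rewrite !comp_lfunE FE !tensor_lactE FE.
Qed.

Definition tensor_fmap (V W : lmodule B) (f : lmod_hom V W) :
  lmod_hom (tensor_lmod M V) (tensor_lmod M W) :=
  LModHom (tensor_fmap_subproof f).

Fact tensor_fmap_id V : tensor_fmap (lmod_id V) = lmod_id (tensor_lmod M V).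
Proof.
apply: lmod_hom_inj; apply: tensor_ext => x y.
by rewrite tensor_mapE1 /= !id_lfunE.
Qed.

Fact tensor_fmap_comp U V W (f : lmod_hom V W) (g : lmod_hom U V) :
  tensor_fmap (lmod_comp f g) = lmod_comp (tensor_fmap f) (tensor_fmap g).
Proof.
apply: lmod_hom_inj; apply: tensor_ext => x y.
by rewrite [RHS]comp_lfunE !tensor_mapE1 /= comp_lfunE.
Qed.

(* M (x)_B - : B-mod -> A-mod. *)
Definition tensor_functor : mod_functor B A :=
  ModFunctor tensor_fmap_id tensor_fmap_comp.

End TensorFunctor.

Definition symm_separably_equivalent (A B : falgType k) : Prop :=
  exists (M : bimodule A B) (N : bimodule B A),
    [/\ lr_projective M, lr_projective N,
        bimod_summand (regular_bimod A) (tensor_bimod M N),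
        bimod_summand (regular_bimod B) (tensor_bimod N M) &
        biadjoint (tensor_functor M) (tensor_functor N)].

End Modules.

Section Invariants.
Variables (k : fieldType) (gT : finGroupType) (A : falgType k).

(* MathComp actions are right actions; for the abelian groups considered here
   they are the same thing as left actions. *)
Record alg_action := AlgAction {
  aact :> {action gT &-> A};
  aact_linear : forall g, linear (aact^~ g);
  aact_monoid : forall g, monoid_morphism (aact^~ g) }.

Variable to : alg_action.

Definition invariants : {vspace A} :=
  (\bigcap_(g : gT) fixedSpace (linfun (to^~ g)))%VS.

Lemma invariantsP a : reflect (forall g, to a g = a) (a \in invariants).
Proof.
rewrite -[a \in _]memvE; apply: (iffP subv_bigcapP) => [aG g|aG g _].
  have := aG g isT; rewrite -memvE => /fixedSpaceP.
  by rewrite linfunE //; apply: aact_linear.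
rewrite -memvE; apply/fixedSpaceP; rewrite linfunE //.
exact: aact_linear.
Qed.

Fact invariants_is_aspace : is_aspace invariants.
Proof.
apply/andP; split.
  by apply/has_algid1/invariantsP=> g; have [] := aact_monoid to g.
apply/prodvP=> a b /invariantsP aG /invariantsP bG; apply/invariantsP=> g.
by have [_ toM] := aact_monoid to g; rewrite toM aG bG.
Qed.

Definition invariant_algebra : falgType k := subvs_of (ASpace invariants_is_aspace).

Variable g : gT.

Definition twisted_rmul : 'Hom(A, 'End(A)) :=
  bilinfun (fun a x : A => x * to a g).

Lemma twisted_rmulE a x : twisted_rmul a x = x * to a g.
Proof.
rewrite /twisted_rmul bilinfunE // => [{}a|{}x c a1 a2]; first exact: mul_linl.
by rewrite (aact_linear to g) mul_linr.
Qed.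

Fact twisted_rmul1 x : twisted_rmul 1 x = x.
Proof.
by have [to1 _] := aact_monoid to g; rewrite twisted_rmulE to1 mulr1.
Qed.
Fact twisted_rmulM a b x :
  twisted_rmul (a * b) x = twisted_rmul b (twisted_rmul a x).
Proof.
by have [_ toM] := aact_monoid to g; rewrite !twisted_rmulE toM mulrA.
Qed.
Fact twisted_mulC a b x :
  lmul A a (twisted_rmul b x) = twisted_rmul b (lmul A a x).
Proof. by rewrite !lmulE !twisted_rmulE mulrA. Qed.

Definition twisted_bimod : bimodule A A :=
  BiModule (@lmul1 _ A) (@lmulM _ A) twisted_rmul1 twisted_rmulM twisted_mulC.

End Invariants.

Record quiver := Quiver {
  vertex : finType;
  arrow : finType;
  source : arrow -> vertex;
  target : arrow -> vertex }.

Section Paths.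
Variable Q : quiver.

Fixpoint is_path (v : vertex Q) (s : seq (arrow Q)) : bool :=
  if s is a :: s' then (source a == v) && is_path (target a) s' else true.

Fixpoint path_end (v : vertex Q) (s : seq (arrow Q)) : vertex Q :=
  if s is a :: s' then path_end (target a) s' else v.

(* A path is its starting vertex with its arrows, listed in the order in which
   they are followed. *)
Record qpath := QPath {
  qpath_val : vertex Q * seq (arrow Q);
  _ : is_path qpath_val.1 qpath_val.2 }.

HB.instance Definition _ := [isSub for qpath_val].
HB.instance Definition _ := [Choice of qpath by <:].

Definition qtriv (v : vertex Q) : qpath := @QPath (v, [::]) isT.

Fact qarrow_subproof (a : arrow Q) : is_path (source a) [:: a].
Proof. by rewrite /= eqxx. Qed.
Definition qarrow (a : arrow Q) : qpath :=
  @QPath (source a, [:: a]) (qarrow_subproof a).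

Definition qstart (p : qpath) : vertex Q := (val p).1.
Definition qend (p : qpath) : vertex Q := path_end (val p).1 (val p).2.

Lemma is_path_cat v s t :
  is_path v (s ++ t) = is_path v s && is_path (path_end v s) t.
Proof. by elim: s v => //= a s IHs v; rewrite IHs andbA. Qed.

Lemma path_end_cat v s t : path_end v (s ++ t) = path_end (path_end v s) t.
Proof. by elim: s v => //= a s IHs v; rewrite IHs. Qed.

(* p followed by q; None when they are not composable. *)
Definition qcat (p q : qpath) : option qpath :=
  if qend p == qstart q then insub ((val p).1, (val p).2 ++ (val q).2) else None.

Lemma qcatE p q r : qcat p q = Some r <->
  qend p = qstart q /\ val r = ((val p).1, (val p).2 ++ (val q).2).
Proof.
rewrite /qcat; case: eqP => [pq|npq]; last by split=> // -[].
case: insubP => [s _ sE|].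
  by split=> [[<-]|[_ rE]]; [rewrite sE | congr Some; apply: val_inj; rewrite sE].
rewrite is_path_cat (valP p) /=.
by move: pq; rewrite /qend /qstart => ->; rewrite (valP q).
Qed.

Lemma qcat_defined p q : qend p = qstart q -> exists r, qcat p q = Some r.
Proof.
move=> pq; case E: (qcat p q) => [r|]; first by exists r.
have := E; rewrite /qcat pq eqxx; case: insubP => // /negP[].
rewrite is_path_cat (valP p) /=.
by move: pq; rewrite /qend /qstart => ->; rewrite (valP q).
Qed.

Lemma qcat_start p q r : qcat p q = Some r -> qstart r = qstart p.
Proof. by case/qcatE=> _ rE; rewrite /qstart rE. Qed.

Lemma qcat_end p q r : qcat p q = Some r -> qend r = qend q.
Proof.
case/qcatE; rewrite /qend /qstart => pq -> /=.
by rewrite path_end_cat pq.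
Qed.

Lemma qcatA p q r : obind (qcat p) (qcat q r) = obind (qcat^~ r) (qcat p q).
Proof.
case qrE : (qcat q r) => [qr|]; case pqE : (qcat p q) => [pq|] //=.
- have [ _ qrv] := iffLR (qcatE _ _ _) qrE.
  have [pq_end pqv] := iffLR (qcatE _ _ _) pqE.
  have [s sE] : exists s, qcat p qr = Some s.
    by apply: qcat_defined; rewrite (qcat_start qrE).
  rewrite sE; apply/esym/qcatE; split.
    by rewrite (qcat_end pqE); case/qcatE: qrE.
  by case/qcatE: sE => _ ->; rewrite pqv qrv /= catA.
- case sE : (qcat p qr) => [s|] //; case/qcatE: sE.
  rewrite (qcat_start qrE) => /qcat_defined[t].
  by rewrite pqE.
- case sE : (qcat pq r) => [s|] //; case/qcatE: sE.
  rewrite (qcat_end pqE) => /qcat_defined[t].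
  by rewrite qrE.
Qed.

End Paths.

Section PathAlgebra.
Variables (k : fieldType) (Q : quiver).

Definition path_algebra : Type := {malg k[qpath Q]}.
HB.instance Definition _ := GRing.Lmodule.on path_algebra.

Definition pa_path (p : qpath Q) : path_algebra := mkmalgU p 1.

Definition pa_vertex (v : vertex Q) : path_algebra := pa_path (qtriv v).
Definition pa_arrow (a : arrow Q) : path_algebra := pa_path (qarrow a).

Definition pa_cat (p q : qpath Q) : path_algebra :=
  oapp pa_path 0 (qcat p q).

Definition pa_one : path_algebra := \sum_(v : vertex Q) pa_vertex v.

Definition pa_mul (x y : path_algebra) : path_algebra :=
  \sum_(p <- msupp x) \sum_(q <- msupp y) (x@_p * y@_q) *: pa_cat p q.

Definition pa_lin (V : lmodType k) (F : qpath Q -> V) (x : path_algebra) : V :=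
  \sum_(p <- msupp x) x@_p *: F p.

Lemma pa_linw (V : lmodType k) (F : qpath Q -> V) (x : path_algebra)
    (d : {fset qpath Q}) : (msupp x `<=` d)%fset ->
  pa_lin F x = \sum_(p <- d) x@_p *: F p.
Proof.
move=> xd; rewrite /pa_lin (big_fset_incl _ xd) // => p _ /mcoeff_outdom ->.
by rewrite scale0r.
Qed.

Lemma pa_lin_linear (V : lmodType k) (F : qpath Q -> V) : linear (pa_lin F).
Proof.
move=> c x y.
pose d := (msupp (c *: x + y) `|` msupp x `|` msupp y)%fset.
rewrite !(@pa_linw _ _ _ d) /d ?fsubsetUr //; last first.
- by rewrite -fsetUA fsubsetUl.
- by rewrite fsetUAC fsubsetUr.
rewrite scaler_sumr -big_split; apply: eq_bigr => p _ /=.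
by rewrite mcoeffD mcoeffZ scalerDl scalerA.
Qed.

Lemma pa_linE (V : lmodType k) (F : qpath Q -> V) p : pa_lin F (pa_path p) = F p.
Proof.
by rewrite (pa_linw _ msuppU_le) big_seq_fset1 mcoeffUU scale1r.
Qed.

Lemma pa_ext (V : lmodType k) (f g : path_algebra -> V) :
  linear f -> linear g -> (forall p, f (pa_path p) = g (pa_path p)) -> f =1 g.
Proof.
move=> fL gL fg x.
pose f' : {linear path_algebra -> V} :=
  HB.pack f (GRing.isLinear.Build k _ _ _ f fL).
pose g' : {linear path_algebra -> V} :=
  HB.pack g (GRing.isLinear.Build k _ _ _ g gL).
have xE : x = \sum_(p <- msupp x) x@_p *: pa_path p.
  rewrite [LHS]monalgE; apply: eq_bigr => p _.
  by apply/malgP=> q; rewrite mcoeffZ !mcoeffU mulr_natr.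
rewrite xE -[f]/(f' : _ -> _) -[g]/(g' : _ -> _) !linear_sum.
by apply: eq_bigr => p _; rewrite !linearZ /= fg.
Qed.

Lemma pa_mulE x y : pa_mul x y = pa_lin (fun p => pa_lin (pa_cat p) y) x.
Proof.
apply: eq_bigr => p _; rewrite scaler_sumr; apply: eq_bigr => q _.
by rewrite scalerA.
Qed.

Lemma pa_mul_linl y : linear (pa_mul^~ y).
Proof. by move=> c x1 x2; rewrite !pa_mulE pa_lin_linear. Qed.

Lemma pa_mul_linr x : linear (pa_mul x).
Proof.
move=> c y1 y2; rewrite !pa_mulE /pa_lin scaler_sumr -big_split /=.
apply: eq_bigr => p _; rewrite -!/(pa_lin _ _) pa_lin_linear.
by rewrite scalerDr !scalerA mulrC.
Qed.

Lemma pa_mul_path p q : pa_mul (pa_path p) (pa_path q) = pa_cat p q.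
Proof. by rewrite pa_mulE !pa_linE. Qed.

Lemma linear_sumf (V W : lmodType k) (f : V -> W) (I : Type) (r : seq I)
  (F : I -> V) : linear f -> f (\sum_(i <- r) F i) = \sum_(i <- r) f (F i).
Proof.
move=> fL.
pose f' : {linear V -> W} := HB.pack f (GRing.isLinear.Build k _ _ _ f fL).
exact: (linear_sum f').
Qed.

Lemma linear_comp (U V W : lmodType k) (f : V -> W) (g : U -> V) :
  linear f -> linear g -> linear (f \o g).
Proof. by move=> fL gL c x y; rewrite /= gL fL. Qed.

Fact pa_mulA : associative pa_mul.
Proof.
move=> x y z; have lL := pa_mul_linl; have rL := pa_mul_linr.
apply: (pa_ext (f := fun x => pa_mul x (pa_mul y z))
  (g := fun x => pa_mul (pa_mul x y) z)) => [||p]; first exact: lL.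
  exact: linear_comp (lL z) (lL y).
apply: (pa_ext (f := fun y => pa_mul (pa_path p) (pa_mul y z))
  (g := fun y => pa_mul (pa_mul (pa_path p) y) z)) => [||q].
- exact: linear_comp (rL _) (lL z).
- exact: linear_comp (lL z) (rL _).
apply: (pa_ext (f := fun z => pa_mul (pa_path p) (pa_mul (pa_path q) z))
  (g := fun z => pa_mul (pa_mul (pa_path p) (pa_path q)) z)) => [||r].
- exact: linear_comp (rL _) (rL _).
- exact: rL.
have mul0 u : pa_mul 0 u = 0 by rewrite /pa_mul msupp0 big_seq_fset0.
have mulr0 u : pa_mul u 0 = 0.
  by rewrite /pa_mul big1 // => s _; rewrite msupp0 big_seq_fset0.
rewrite !pa_mul_path /pa_cat; have := qcatA p q r.
case: (qcat q r) => [qr|] /=; case: (qcat p q) => [pq|] /= E;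
  by rewrite ?mulr0 ?mul0 ?pa_mul_path /pa_cat ?E // -E.
Qed.

Fact pa_mul1 : left_id pa_one pa_mul.
Proof.
apply: pa_ext => [||p] //; first exact: pa_mul_linr.
rewrite /pa_one (linear_sumf _ _ (pa_mul_linl _)) (bigD1 (qstart p)) //= big1.
  rewrite addr0 pa_mul_path /pa_cat.
  have /qcatE -> // : qend (qtriv (qstart p)) = qstart p /\
    val p = ((val (qtriv (qstart p))).1, (val (qtriv (qstart p))).2 ++ (val p).2).
  by split=> //; case: (p) => [[]].
move=> v vp; rewrite pa_mul_path /pa_cat /qcat /qend /=.
by rewrite (negbTE vp).
Qed.

Fact pa_mulr1 : right_id pa_one pa_mul.
Proof.
apply: pa_ext => [||p] //; first exact: pa_mul_linl.
rewrite /pa_one (linear_sumf _ _ (pa_mul_linr _)) (bigD1 (qend p)) //= big1.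
  rewrite addr0 pa_mul_path /pa_cat.
  have /qcatE -> // : qend p = qstart (qtriv (qend p)) /\
    val p = ((val p).1, (val p).2 ++ (val (qtriv (qend p))).2).
  by split=> //=; rewrite cats0; case: (p) => [[]].
move=> v vp; rewrite pa_mul_path /pa_cat /qcat eq_sym.
by rewrite (negbTE vp).
Qed.

Fact pa_mulDl : left_distributive pa_mul +%R.
Proof. by move=> x y z; have := pa_mul_linl z 1 x y; rewrite !scale1r. Qed.

Fact pa_mulDr : right_distributive pa_mul +%R.
Proof. by move=> x y z; have := pa_mul_linr x 1 y z; rewrite !scale1r. Qed.

HB.instance Definition _ := GRing.Zmodule_isPzRing.Build path_algebra
  pa_mulA pa_mul1 pa_mulr1 pa_mulDl pa_mulDr.

End PathAlgebra.

Section Ideals.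
Variable R : pzRingType.
Implicit Types I J S : R -> Prop.

Definition is_ideal I : Prop :=
  [/\ I 0, forall x y, I x -> I y -> I (x + y) &
      forall a x b, I x -> I (a * x * b)].

Definition ideal_gen S : R -> Prop := fun x =>
  forall I, is_ideal I -> (forall y, S y -> I y) -> I x.

Definition ideal_mul I J : R -> Prop :=
  ideal_gen (fun z => exists x y, [/\ I x, J y & z = x * y]).

Fixpoint ideal_exp I (m : nat) : R -> Prop :=
  if m is m'.+1 then ideal_mul I (ideal_exp I m') else fun _ => True.

End Ideals.

Section BoundQuivers.
Variables (k : fieldType) (Q : quiver).

Definition arrow_ideal : path_algebra k Q -> Prop :=
  ideal_gen (fun x => exists a, x = pa_arrow k a).

Definition admissible (I : path_algebra k Q -> Prop) : Prop :=
  [/\ is_ideal I,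
      (exists2 m, (2 <= m)%N & forall x, ideal_exp arrow_ideal m x -> I x) &
      forall x, I x -> ideal_exp arrow_ideal 2 x].

(* The surjective algebra morphism pi identifies A with kQ / I, I = ker pi. *)
Definition bound_quiver_presentation (A : falgType k)
    (pi : {linear path_algebra k Q -> A}) : Prop :=
  [/\ monoid_morphism pi, (forall a, exists x, pi x = a) &
      admissible (fun x => pi x = 0)].

End BoundQuivers.

(* A is basic, presented as kQ / I, and the action permutes the vertex
   idempotents and the arrows of Q through the actions tv and ta on the quiver,
   with tv free (whence ta is free too). *)
Definition basic_with_free_quiver_action (k : fieldType) (gT : finGroupType)
    (A : falgType k) (to : alg_action gT A) : Prop :=
  exists (Q : quiver) (pi : {linear path_algebra k Q -> A})
    (tv : {action gT &-> vertex Q}) (ta : {action gT &-> arrow Q}),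
    [/\ bound_quiver_presentation pi,
        forall g a, source (ta a g) = tv (source a) g /\
                    target (ta a g) = tv (target a) g,
        forall g v, to (pi (pa_vertex k v)) g = pi (pa_vertex k (tv v g)),
        forall g a, to (pi (pa_arrow k a)) g = pi (pa_arrow k (ta a g)) &
        forall g v, tv v g = v -> g = 1%g].

(* Main.v *)
Require Import Defs.
From mathcomp Require Import all_boot all_order all_algebra all_fingroup all_field.
From mathcomp Require Import boolp.

Set Implicit Arguments.
Unset Strict Implicit.
Unset Printing Implicit Defensive.

Import GRing.Theory.
Local Open Scope ring_scope.

(** Write B for the invariant algebra A^G, Ind for A as an A-B-bimodule and Res
    for A as a B-A-bimodule, so that Ind (x)_B - is induction and Res (x)_A - is
    restriction.  All three statements come from two pairings between these
    bimodules, each with a pair of dual bases.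

    The first pairing, Ind x Res -> A, is the multiplication x y; the element 1
    is its own dual basis.  It exists for every subalgebra.

    The second pairing, Res x Ind -> B, is tr (x y), where tr a is the sum of
    the g(a).  When G permutes freely a complete family of orthogonal idempotents
    e_v (here the vertices of the quiver), e_v g(e_v) = 0 for every g <> 1, so
    that e_v tr(e_v a) = e_v a (trace_recoverl) and tr(a e_v) e_v = a e_v
    (trace_recoverr): the family (e_v) is dual to itself.  Thus A is a Frobenius
    extension of B with trace form tr.

    A pairing M x N -> A with dual bases (m_i), (n_i) yields
    - evaluation M (x)_B N -> A and coevaluation B -> N (x)_A M, the latter
      sending 1 to the sum of the n_i (x) m_i;
    - projectivity of M on the left and of N on the right, the dual bases being
      projective coordinate systems;
    - an adjunction between M (x)_B - and N (x)_A -.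

    The two pairings together give left-right projectivity of Ind and Res, and
    biadjointness of induction and restriction.  Evaluating the coevaluation of
    the second pairing by the first gives a |-> sum_v a e_v e_v = a, so A is a
    summand of Ind (x)_B Res (separable_summand).  Evaluating the coevaluation
    of the first pairing by the second gives b |-> tr b = |G| b, so B is a
    summand of Res (x)_A Ind as soon as |G| is invertible
    (expectation_summand, invariants_summand). *)

(** * Linear maps out of tensor products *)

Section TensorMaps.
Variable k : fieldType.

(** The map is chosen by a sig type rather than merely shown to exist, so that
    the maps obtained for all modules can be assembled into a natural
    transformation. *)
Lemma tensor_lift (B : falgType k) (M : rmodule B) (N : lmodule B)
    (W : vectType k) (h : M -> N -> W) :
    (forall x, linear (h x)) -> (forall y, linear (h^~ y)) ->
    (forall x b y, h (rm_act M b x) y = h x (lm_act N b y)) ->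
  {f : 'Hom(tensor M N, W) | forall x y, f (tens x y) = h x y}.
Proof.
move=> hr hl hA; apply: cid.
by have [f [fE _]] := tensor_universal hr hl hA; exists f.
Qed.

(** Stated for functions rather than elements of 'Hom, so that it applies to any
    expression that is linear in a tensor. *)
Lemma tensor_eq (B : falgType k) (M : rmodule B) (N : lmodule B)
    (W : vectType k) (f g : tensor M N -> W) :
    linear f -> linear g -> (forall x y, f (tens x y) = g (tens x y)) ->
  f =1 g.
Proof.
move=> fL gL fg z; rewrite -(linfunE fL) -(linfunE gL).
by congr (fun_of_lfun _ z); apply: tensor_ext => x y; rewrite !linfunE.
Qed.

Lemma lm_act_linl (A : falgType k) (V : lmodule A) v :
  linear (fun a => lm_act V a v).
Proof. by move=> c a b; rewrite linearP add_lfunE scale_lfunE. Qed.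

Lemma rm_act_linl (A : falgType k) (V : rmodule A) v :
  linear (fun a => rm_act V a v).
Proof. by move=> c a b; rewrite linearP add_lfunE scale_lfunE. Qed.

Lemma lfun_sum (U V : vectType k) (f : 'Hom(U, V)) (I : finType)
    (F : I -> U) : f (\sum_i F i) = \sum_i f (F i).
Proof. exact: linear_sum. Qed.

Lemma fmap_tens (A B : falgType k) (M : bimodule A B) (V W : lmodule B)
    (f : lmod_hom V W) x y :
  fmap (tensor_functor M) f (tens (M := bm_right M) x y) =
    tens (M := bm_right M) x (f y).
Proof. exact: tensor_mapE1. Qed.

Lemma tens_sumr (B : falgType k) (M : rmodule B) (N : lmodule B) (I : finType)
    x (F : I -> N) : tens (M := M) x (\sum_i F i) = \sum_i tens x (F i).
Proof. exact: (linear_sumf _ _ (tens_linr x)). Qed.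

Lemma tens_suml (B : falgType k) (M : rmodule B) (N : lmodule B) (I : finType)
    (F : I -> M) (y : N) : tens (\sum_i F i) y = \sum_i tens (F i) y.
Proof. exact: (linear_sumf _ _ (tens_linl y)). Qed.

End TensorMaps.

(** * Retracts are direct summands *)

Section Retracts.
Variables (k : fieldType) (A B : falgType k) (N R : bimodule A B).
Variable p : 'Hom(N, R).
Hypothesis pB : is_bimod_hom p.
Let K := subvs_of (lker p).

Fact ker_lact_mem a (x : K) : bm_lact N a (vsval x) \in lker p.
Proof.
by rewrite memv_ker pB.1; have := subvsP x; rewrite memv_ker => /eqP->;
  rewrite linear0.
Qed.

Fact ker_ract_mem b (x : K) : bm_ract N b (vsval x) \in lker p.
Proof.
by rewrite memv_ker pB.2; have := subvsP x; rewrite memv_ker => /eqP->;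
  rewrite linear0.
Qed.

Definition ker_lact : 'Hom(A, 'End(K)) :=
  bilinfun (fun a (x : K) => vsproj (lker p) (bm_lact N a (vsval x))).
Definition ker_ract : 'Hom(B, 'End(K)) :=
  bilinfun (fun b (x : K) => vsproj (lker p) (bm_ract N b (vsval x))).

Lemma ker_lactE a x : vsval (ker_lact a x) = bm_lact N a (vsval x).
Proof.
rewrite /ker_lact bilinfunE ?vsprojK ?ker_lact_mem //.
  by move=> {}a c y z; rewrite !linearP.
by move=> {}x c b d; rewrite !linearP add_lfunE scale_lfunE !linearP.
Qed.

Lemma ker_ractE b x : vsval (ker_ract b x) = bm_ract N b (vsval x).
Proof.
rewrite /ker_ract bilinfunE ?vsprojK ?ker_ract_mem //.
  by move=> {}b c y z; rewrite !linearP.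
by move=> {}x c a d; rewrite !linearP add_lfunE scale_lfunE !linearP.
Qed.

Fact ker_lact1 x : ker_lact 1 x = x.
Proof. by apply: val_inj; rewrite /= ker_lactE bm_lact1. Qed.
Fact ker_lactM a b x : ker_lact (a * b) x = ker_lact a (ker_lact b x).
Proof. by apply: val_inj; rewrite /= !ker_lactE bm_lactM. Qed.
Fact ker_ract1 x : ker_ract 1 x = x.
Proof. by apply: val_inj; rewrite /= ker_ractE bm_ract1. Qed.
Fact ker_ractM a b x : ker_ract (a * b) x = ker_ract b (ker_ract a x).
Proof. by apply: val_inj; rewrite /= !ker_ractE bm_ractM. Qed.
Fact ker_actC a b x : ker_lact a (ker_ract b x) = ker_ract b (ker_lact a x).
Proof.
by apply: val_inj; rewrite /= ker_lactE !ker_ractE ker_lactE bm_actC.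
Qed.

Definition ker_bimod : bimodule A B :=
  BiModule ker_lact1 ker_lactM ker_ract1 ker_ractM ker_actC.

(** N = i(R) + ker p, the projection onto ker p being z - i (p z). *)
Lemma retract_summand (i : 'Hom(R, N)) :
  is_bimod_hom i -> cancel i p -> bimod_summand R N.
Proof.
move=> iB iK; exists ker_bimod.
have subK z : z - i (p z) \in lker p.
  by rewrite memv_ker linearB /= iK subrr.
pose F z : (R * K)%type := (p z, vsproj (lker p) (z - i (p z))).
have FL : linear F.
  move=> c x y; rewrite /F [p _]linearP [i _]linearP.
  by rewrite opprD addrACA -scalerBr linearP.
exists (linfun F : 'Hom(N, dsum_bimod R ker_bimod)); split.
  split=> [a|b] z; rewrite /= !(linfunE FL) /F.
    rewrite [RHS](@dsum_lactE _ _ _ R ker_bimod) /=.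
    congr pair; first by rewrite pB.1.
    by apply: val_inj; rewrite /= ker_lactE !vsprojK // pB.1 iB.1 linearB.
  rewrite [RHS](@dsum_ractE _ _ _ R ker_bimod) /=.
  congr pair; first by rewrite pB.2.
  by apply: val_inj; rewrite /= ker_ractE !vsprojK // pB.2 iB.2 linearB.
exists (fun w : (R * K)%type => i w.1 + vsval w.2) => [z|[x y]].
  by rewrite linfunE //= vsprojK // addrC subrK.
rewrite linfunE // /F /= linearD /= iK.
have := subvsP y; rewrite memv_ker => /eqP->; rewrite addr0.
by congr pair; rewrite addrC addKr vsvalK.
Qed.

End Retracts.

(** * Adjunctions and dual bases *)

Section UnitCounit.
Variables (k : fieldType) (A B : falgType k).
Variables (F : mod_functor A B) (G : mod_functor B A).

Lemma unit_counit_adjoint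
    (eta : forall V, lmod_hom V (G (F V)))
    (eps : forall W, lmod_hom (F (G W)) W) :
    (forall V V' (u : lmod_hom V' V) x,
       fmap G (fmap F u) (eta V' x) = eta V (u x)) ->
    (forall W W' (w : lmod_hom W W') y,
       w (eps W y) = eps W' (fmap F (fmap G w) y)) ->
    (forall V y, eps (F V) (fmap F (eta V) y) = y) ->
    (forall W x, fmap G (eps W) (eta (G W) x) = x) ->
  left_adjoint F G.
Proof.
move=> etaN epsN tri1 tri2.
exists (fun V W f => lmod_comp (fmap G f) (eta V)); split=> [V W|].
  exists (fun g => lmod_comp (eps W) (fmap F g)) => [f|g];
    apply: lmod_hom_inj; apply/lfunP=> x; rewrite /= fmap_comp /= !comp_lfunE.
    by rewrite -epsN tri1.
  by rewrite etaN tri2.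
move=> V V' W W' u w f; apply: lmod_hom_inj; apply/lfunP=> x.
by rewrite !fmap_comp /= !comp_lfunE etaN.
Qed.

End UnitCounit.

Section Pairings.
Variables (k : fieldType) (A B : falgType k).
Variables (M : bimodule A B) (N : bimodule B A).

(** A bimodule map M (x)_B N -> A, given before passing to the tensor
    product. *)
Record pairing := Pairing {
  pair_fun :> M -> N -> A;
  pair_linr : forall x, linear (pair_fun x);
  pair_linl : forall y, linear (pair_fun^~ y);
  pairC : forall x b y, pair_fun (bm_ract M b x) y = pair_fun x (bm_lact N b y);
  pair_lact : forall a x y, pair_fun (bm_lact M a x) y = a * pair_fun x y;
  pair_ract : forall a x y, pair_fun x (bm_ract N a y) = pair_fun x y * a }.

Variable beta : pairing.

Lemma pairing_ev : {f : 'Hom(tensor_bimod M N, regular_bimod A) |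
  is_bimod_hom f & forall x y,
    f (tens (M := bm_right M) (N := bm_left N) x y) = beta x y}.
Proof.
have [f fE] := @tensor_lift _ _ (bm_right M) (bm_left N) A beta
  (@pair_linr beta) (@pair_linl beta) (@pairC beta).
exists f => //; split=> [a|b].
  apply: tensor_eq => [c x y|c x y|x y]; rewrite ?linearP //.
  by rewrite tensor_lactE !fE pair_lact /= lmulE.
apply: tensor_eq => [c x y|c x y|x y]; rewrite ?linearP //.
by rewrite tensor_ractE !fE pair_ract /= rmulE.
Qed.

Variables (I : finType) (m : I -> M) (n : I -> N).

(** The triangle identities of an adjunction, in coordinates. *)
Definition dual_bases :=
  (forall x, \sum_i bm_lact M (beta x (n i)) (m i) = x) /\
  (forall y, \sum_i bm_ract N (beta (m i) y) (n i) = y).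

Hypothesis mnP : dual_bases.

(** x |-> (beta x n_i)_i embeds M in a free module, and (a_i) |-> sum a_i m_i
    retracts it; so choosing preimages of the f(m_i) lifts all of f. *)
Lemma dual_bases_lprojective : lprojective (bm_left M).
Proof.
move=> X Y e f eA e_surj fA.
have [x xE] := fin_all_exists (fun i => e_surj (f (m i))).
pose g z := \sum_i lm_act X (beta z (n i)) (x i).
have gL : linear g.
  move=> c y z; rewrite /g scaler_sumr -big_split; apply: eq_bigr => i _ /=.
  by rewrite pair_linl lm_act_linl.
exists (linfun g); split.
  move=> a z; rewrite !(linfunE gL) /g linear_sum; apply: eq_bigr => i _.
  by rewrite pair_lact lm_actM.
apply/lfunP=> z; rewrite comp_lfunE linfunE // linear_sum.
rewrite -[in RHS](mnP.1 z) linear_sum; apply: eq_bigr => i _ /=.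
by rewrite eA xE -fA.
Qed.

Lemma dual_bases_rprojective : rprojective (bm_right N).
Proof.
move=> X Y e f eA e_surj fA.
have [x xE] := fin_all_exists (fun i => e_surj (f (n i))).
pose g z := \sum_i rm_act X (beta (m i) z) (x i).
have gL : linear g.
  move=> c y z; rewrite /g scaler_sumr -big_split; apply: eq_bigr => i _ /=.
  by rewrite pair_linr rm_act_linl.
exists (linfun g); split.
  move=> a z; rewrite !(linfunE gL) /g linear_sum; apply: eq_bigr => i _.
  by rewrite pair_ract rm_actM.
apply/lfunP=> z; rewrite comp_lfunE linfunE // linear_sum.
rewrite -[in RHS](mnP.2 z) linear_sum; apply: eq_bigr => i _ /=.
by rewrite eA xE -fA.
Qed.

(** The element u = sum_i n_i (x) m_i of N (x)_A M satisfies b u = u b: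
    expanding b n_i in the n_j and m_j b in the m_i gives the same double sum,
    of the n_j (x) beta(m_j, b n_i) m_i.  The tensor product is replaced by an
    arbitrary balanced map h, because the unit of the adjunction needs the case
    h(n, m) = n (x) (m (x) v). *)
Lemma dual_bases_central (W : vectType k) (h : N -> M -> W) b :
    (forall x, linear (h x)) -> (forall y, linear (h^~ y)) ->
    (forall x a y, h (bm_ract N a x) y = h x (bm_lact M a y)) ->
  \sum_i h (bm_lact N b (n i)) (m i) = \sum_i h (n i) (bm_ract M b (m i)).
Proof.
move=> hr hl hA.
transitivity (\sum_i \sum_j
    h (n j) (bm_lact M (beta (m j) (bm_lact N b (n i))) (m i))).
  apply: eq_bigr => i _; rewrite -[bm_lact N b (n i)]mnP.2.
  rewrite (linear_sumf _ _ (hl (m i))); apply: eq_bigr => j _.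
  by rewrite hA mnP.2.
rewrite exchange_big; apply: eq_bigr => j _.
rewrite -[bm_ract M b (m j)]mnP.1 (linear_sumf _ _ (hr (n j))).
by apply: eq_bigr => i _; rewrite pairC.
Qed.

Lemma dual_bases_coev :
  {f : 'Hom(regular_bimod B, tensor_bimod N M) | is_bimod_hom f &
    forall b, f b = \sum_i tens (M := bm_right N) (N := bm_left M)
                             (bm_lact N b (n i)) (m i)}.
Proof.
pose f b : tensor (bm_right N) (bm_left M) :=
  \sum_i tens (M := bm_right N) (N := bm_left M) (bm_lact N b (n i)) (m i).
have fL : linear f.
  move=> c y z; rewrite /f scaler_sumr -big_split; apply: eq_bigr => i _ /=.
  by rewrite (lm_act_linl (V := bm_left N)) tens_linl.
exists (linfun f : 'Hom(regular_bimod B, tensor_bimod N M));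
  last by move=> b; rewrite (linfunE fL).
split=> [a|b] x /=; rewrite !(linfunE fL) /f linear_sum.
  apply: eq_bigr => i _; rewrite /= tensor_lactE lmulE.
  by rewrite bm_lactM.
under [RHS]eq_bigr => i _ do rewrite /= tensor_ractE.
rewrite rmulE; under [LHS]eq_bigr => i _ do rewrite bm_lactM.
pose h y z := tens (M := bm_right N) (N := bm_left M) (bm_lact N x y) z.
apply: (@dual_bases_central _ h b) => [y c z1 z2|z c y1 y2|y a z].
- by rewrite /h tens_linr.
- by rewrite /h linearP tens_linl.
by rewrite /h bm_actC (tensA (M := bm_right N) (N := bm_left M)).
Qed.


(** The counit M (x) (N (x) W) -> W is defined in two steps, first for a fixed
    x in M, which avoids the associativity of the tensor product. *)
Lemma pairing_counit (W : lmodule A) :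
  {f : lmod_hom (tensor_lmod M (tensor_lmod N W)) W | forall x y w,
    f (tens (M := bm_right M) (N := tensor_lmod N W) x
         (tens (M := bm_right N) y w)) =
      lm_act W (beta x y) w}.
Proof.
pose T := tensor_lmod N W.
have g x : {f : 'Hom(T, W) | forall y w,
    f (tens (M := bm_right N) y w) = lm_act W (beta x y) w}.
  apply: (tensor_lift (M := bm_right N)) => [y|w c y z|y a w].
  - exact: linearP.
  - by rewrite pair_linr lm_act_linl.
  by rewrite /= pair_ract lm_actM.
have [f fE] : {f : 'Hom(tensor_lmod M T, W) | forall x z,
    f (tens (M := bm_right M) x z) = sval (g x) z}.
  apply: (tensor_lift (M := bm_right M)) => [x|z c x1 x2|x b].
  - exact: linearP.
  - rewrite -scale_lfunE -add_lfunE; congr (fun_of_lfun _ z).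
    apply: tensor_ext => y w; rewrite add_lfunE scale_lfunE !(svalP (g _)).
    by rewrite pair_linl lm_act_linl.
  apply: tensor_eq => [d y z|d y z|y w]; rewrite ?linearP //.
  by rewrite /= tensor_lactE !(svalP (g _)) pairC.
have fA : is_lmod_hom f.
  move=> a; apply: tensor_eq => [c y z|c y z|x]; rewrite ?linearP //.
  apply: (@tensor_eq _ _ (bm_right N) W W) => [c y z|c y z|y w].
  - by rewrite tens_linr !linearP.
  - by rewrite tens_linr !linearP.
  by rewrite tensor_lactE !fE !(svalP (g _)) pair_lact lm_actM.
by exists (LModHom fA) => x y w; rewrite /= fE (svalP (g x)).
Qed.

Lemma dual_bases_unit (V : lmodule B) :
  {f : lmod_hom V (tensor_lmod N (tensor_lmod M V)) | forall v,
    f v = \sum_i tens (M := bm_right N) (N := tensor_lmod M V) (n i)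
                    (tens (M := bm_right M) (m i) v)}.
Proof.
pose f v : tensor_lmod N (tensor_lmod M V) :=
  \sum_i tens (M := bm_right N) (N := tensor_lmod M V) (n i)
           (tens (M := bm_right M) (m i) v).
have fL : linear f.
  move=> c v w; rewrite /f scaler_sumr -big_split; apply: eq_bigr => i _ /=.
  by rewrite !tens_linr.
have fB : is_lmod_hom (linfun f : 'Hom(V, tensor_lmod N (tensor_lmod M V))).
  move=> b v; rewrite /= !(linfunE fL) /f linear_sum.
  under [RHS]eq_bigr => i _ do rewrite /= tensor_lactE.
  under [LHS]eq_bigr => i _ do rewrite -(tensA (M := bm_right M)).
  pose h y x := tens (M := bm_right N) (N := tensor_lmod M V) y
                  (tens (M := bm_right M) x v).
  apply/esym; apply: (@dual_bases_central _ h b) => [y c x z|z c y1 y2|y a x].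
  - by rewrite /h tens_linl tens_linr.
  - by rewrite /h tens_linl.
  by rewrite /h (tensA (M := bm_right N)) /= tensor_lactE.
by exists (LModHom fB) => v; rewrite /= (linfunE fL).
Qed.

Lemma dual_bases_adjoint :
  left_adjoint (tensor_functor M) (tensor_functor N).
Proof.
apply: (@unit_counit_adjoint _ _ _ (tensor_functor M) (tensor_functor N)
  (fun V => sval (dual_bases_unit V))
  (fun W => sval (pairing_counit W))).
- move=> V V' u x; rewrite !(svalP (dual_bases_unit _)) lfun_sum.
  by apply: eq_bigr => i _; rewrite !fmap_tens.
- move=> W W' w; apply: (@tensor_eq _ _ (bm_right M) (tensor_lmod N W) W')
    => [c y z|c y z|x]; rewrite ?linearP //.
  apply: (@tensor_eq _ _ (bm_right N) W W') => [c y z|c y z|y z].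
  - by rewrite tens_linr !linearP.
  - by rewrite tens_linr !linearP.
  by rewrite !fmap_tens !(svalP (pairing_counit _)) lmod_funP.
- move=> V; apply: (@tensor_eq _ _ (bm_right M) V (tensor_lmod M V))
    => [c y z|c y z|x v]; rewrite ?linearP //.
  rewrite fmap_tens (svalP (dual_bases_unit _)) tens_sumr lfun_sum.
  rewrite -[in RHS](mnP.1 x) tens_suml; apply: eq_bigr => i _.
  by rewrite (svalP (pairing_counit _)) tensor_lactE.
move=> W; apply: (@tensor_eq _ _ (bm_right N) W (tensor_lmod N W))
  => [c y z|c y z|y w]; rewrite ?linearP //.
rewrite (svalP (dual_bases_unit _)) lfun_sum.
rewrite -[in RHS](mnP.2 y) tens_suml; apply: eq_bigr => i _.
by rewrite fmap_tens (svalP (pairing_counit _)) (tensA (M := bm_right N)).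
Qed.

End Pairings.

(** * Induction and restriction along a subalgebra *)

Section Subalgebra.
Variables (k : fieldType) (A : falgType k) (U : {aspace A}).
(* The unit of U may be any idempotent of A; only when it is 1 is A a unital
   module over U. *)
Hypothesis U1 : 1 \in U.
Let B : falgType k := subvs_of U.

Lemma sub_one : vsval (1 : B) = 1.
Proof. by apply/eqP; rewrite algid_eq1. Qed.

Definition sub_lact : 'Hom(B, 'End(A)) :=
  bilinfun (fun (b : B) (x : A) => vsval b * x).
Definition sub_ract : 'Hom(B, 'End(A)) :=
  bilinfun (fun (b : B) (x : A) => x * vsval b).

Lemma sub_lactE b x : sub_lact b x = vsval b * x.
Proof.
rewrite /sub_lact bilinfunE // => [{}b|{}x c b1 b2]; first exact: mul_linr.
by rewrite linearP mul_linl.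
Qed.
Lemma sub_ractE b x : sub_ract b x = x * vsval b.
Proof.
rewrite /sub_ract bilinfunE // => [{}b|{}x c b1 b2]; first exact: mul_linl.
by rewrite linearP mul_linr.
Qed.

Fact sub_lact1 x : sub_lact 1 x = x.
Proof. by rewrite sub_lactE sub_one mul1r. Qed.
Fact sub_lactM a b x : sub_lact (a * b) x = sub_lact a (sub_lact b x).
Proof. by rewrite !sub_lactE mulrA. Qed.
Fact sub_ract1 x : sub_ract 1 x = x.
Proof. by rewrite sub_ractE sub_one mulr1. Qed.
Fact sub_ractM a b x : sub_ract (a * b) x = sub_ract b (sub_ract a x).
Proof. by rewrite !sub_ractE mulrA. Qed.
Fact sub_lract_actC a b x :
  lmul A a (sub_ract b x) = sub_ract b (lmul A a x).
Proof. by rewrite !(lmulE, sub_ractE) mulrA. Qed.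
Fact sub_rlact_actC b a x :
  sub_lact b (rmul A a x) = rmul A a (sub_lact b x).
Proof. by rewrite !(rmulE, sub_lactE) mulrA. Qed.

Definition ind_bimod : bimodule A B :=
  BiModule (@lmul1 _ A) (@lmulM _ A) sub_ract1 sub_ractM sub_lract_actC.
Definition res_bimod : bimodule B A :=
  BiModule sub_lact1 sub_lactM (@rmul1 _ A) (@rmulM _ A) sub_rlact_actC.

Definition mul_pairing : pairing ind_bimod res_bimod.
Proof.
apply: (@Pairing _ _ _ ind_bimod res_bimod (fun x y : A => x * y)).
- exact: mul_linr.
- exact: mul_linl.
- by move=> x b y; rewrite /= sub_ractE sub_lactE mulrA.
- by move=> a x y; rewrite /= lmulE mulrA.
- by move=> a x y; rewrite /= rmulE mulrA.
Defined.

Lemma mul_dual_bases :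
  dual_bases mul_pairing (fun _ : 'I_1 => 1 : A) (fun _ : 'I_1 => 1 : A).
Proof.
by split=> x; rewrite big_ord1 /= ?lmulE ?rmulE ?mulr1 ?mul1r.
Qed.

(* E stands for the trace below, or for its average when that exists. *)
Variable E : A -> B.
Hypotheses (E_linear : linear E)
  (E_lact : forall b x, E (vsval b * x) = b * E x)
  (E_ract : forall b x, E (x * vsval b) = E x * b).

Definition frobenius_pairing : pairing res_bimod ind_bimod.
Proof.
apply: (@Pairing _ _ _ res_bimod ind_bimod (fun x y : A => E (x * y))).
- by move=> x c y z; rewrite mul_linr E_linear.
- by move=> y c x z; rewrite mul_linl E_linear.
- by move=> x b y; rewrite /= rmulE lmulE mulrA.
- by move=> a x y; rewrite /= sub_lactE -mulrA E_lact.
- by move=> a x y; rewrite /= sub_ractE mulrA E_ract.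
Defined.

(** The splitting b |-> b (x) 1, x (x) y |-> E (x y). *)
Lemma expectation_summand :
  E 1 = 1 -> bimod_summand (regular_bimod B) (tensor_bimod res_bimod ind_bimod).
Proof.
move=> E1; have [p pB pE] := pairing_ev frobenius_pairing.
have [i iB iE] := dual_bases_coev mul_dual_bases.
apply: (retract_summand pB iB) => b.
by rewrite iE big_ord1 pE /= sub_lactE -mulrA E_lact mulr1 E1 mulr1.
Qed.

(** The sum of the x_i (x) y_i commutes with A, since it is the coevaluation at
    1, and multiplies to 1: it is a separability idempotent. *)
Lemma separable_summand (I : finType) (x y : I -> A) :
    dual_bases frobenius_pairing y x -> \sum_i x i * y i = 1 ->
  bimod_summand (regular_bimod A) (tensor_bimod ind_bimod res_bimod).
Proof.
move=> xyP xy1; have [p pB pE] := pairing_ev mul_pairing.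
have [i iB iE] := dual_bases_coev xyP.
apply: (retract_summand pB iB) => a.
rewrite iE lfun_sum -[RHS]mulr1 -xy1 mulr_sumr; apply: eq_bigr => j _.
by rewrite pE /= lmulE mulrA.
Qed.

(** Each of the two pairings proves one half of the projectivity of either
    bimodule and one of the two adjunctions. *)
Lemma frobenius_symm_separable (I : finType) (x y : I -> A) :
    dual_bases frobenius_pairing y x -> \sum_i x i * y i = 1 ->
    bimod_summand (regular_bimod B) (tensor_bimod res_bimod ind_bimod) ->
  symm_separably_equivalent A B.
Proof.
move=> xyP xy1 sumB; exists ind_bimod, res_bimod; split=> //.
- split; first exact: dual_bases_lprojective mul_dual_bases.
  exact: dual_bases_rprojective xyP.
- split; first exact: dual_bases_lprojective xyP.
  exact: dual_bases_rprojective mul_dual_bases.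
- exact: separable_summand xyP xy1.
split; first exact: dual_bases_adjoint mul_dual_bases.
exact: dual_bases_adjoint xyP.
Qed.

End Subalgebra.

(** * The trace onto the invariants *)

(** The carrier of the action need not be finite. *)
Section TotalActions.
Variables (gT : finGroupType) (T : Type) (to : {action gT &-> T}).

Lemma total_actM x g h : to x (g * h)%g = to (to x g) h.
Proof. by case: to => f [_ fM] /=; apply: fM; rewrite inE. Qed.

Lemma total_act1 x : to x 1%g = x.
Proof.
have to_inj : left_injective to by case: to => f [].
by apply: (to_inj 1%g); rewrite -total_actM mulg1.
Qed.

End TotalActions.

Section Trace.
Variables (k : fieldType) (A : falgType k) (gT : finGroupType).
Variable to : alg_action gT A.
Let B := invariant_algebra to.

Lemma act_mul a b g : to (a * b) g = to a g * to b g.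
Proof. by have [_ toM] := aact_monoid to g; rewrite toM. Qed.

Lemma act_one g : to 1 g = 1.
Proof. by have [] := aact_monoid to g. Qed.

Lemma act_sum (I : finType) (F : I -> A) g :
  to (\sum_i F i) g = \sum_i to (F i) g.
Proof. exact: (linear_sumf _ _ (aact_linear to g)). Qed.

Definition invariant_aspace : {aspace A} := ASpace (invariants_is_aspace to).

Lemma invariants1 : 1 \in invariant_aspace.
Proof. by apply/invariantsP => g; rewrite act_one. Qed.

Fact trace_invariant a : \sum_g to a g \in invariants to.
Proof.
apply/invariantsP => h; rewrite act_sum [RHS](reindex_inj (mulIg h)) /=.
by apply: eq_bigr => g _; rewrite total_actM.
Qed.

Definition trace (a : A) : B := vsproj (invariants to) (\sum_g to a g).

Lemma traceE a : vsval (trace a) = \sum_g to a g.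
Proof. by rewrite vsprojK // trace_invariant. Qed.

Lemma invariantE (b : B) g : to (vsval b) g = vsval b.
Proof. by have /invariantsP-> := subvsP b. Qed.

Lemma trace_linear : linear trace.
Proof.
move=> c x y; apply: val_inj; rewrite /= !traceE scaler_sumr -big_split.
by apply: eq_bigr => g _; rewrite (aact_linear to g).
Qed.

Lemma trace_lact b x : trace (vsval b * x) = b * trace x.
Proof.
apply: val_inj; rewrite /= !traceE mulr_sumr.
by apply: eq_bigr => g _; rewrite act_mul invariantE.
Qed.

Lemma trace_ract b x : trace (x * vsval b) = trace x * b.
Proof.
apply: val_inj; rewrite /= !traceE mulr_suml.
by apply: eq_bigr => g _; rewrite act_mul invariantE.
Qed.

Lemma invariants_summand :
    (forall p, p \in [pchar k] -> ~~ (p %| #|gT|)%N) ->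
  bimod_summand (regular_bimod B)
    (tensor_bimod (res_bimod invariants1) (ind_bimod invariants1)).
Proof.
move=> charG; have G_unit : #|gT|%:R != 0 :> k.
  rewrite natf_neq0_pchar; apply/pnatP => [|p p_pr pG].
    by apply/card_gt0P; exists 1%g.
  by apply/negP => /charG; rewrite pG.
(* The average over G restricts to the identity of the invariants. *)
pose E a : B := #|gT|%:R^-1 *: trace a.
apply: (@expectation_summand _ _ _ invariants1 E).
- by move=> c x y; rewrite /E trace_linear scalerDr !scalerA mulrC.
- by move=> b x; rewrite /E trace_lact scalerAr.
- by move=> b x; rewrite /E trace_ract scalerAl.
apply: val_inj; rewrite /= traceE.
under eq_bigr => g _ do rewrite act_one.
rewrite sumr_const -scaler_nat scalerA mulVf // scale1r.
by rewrite -(sub_one invariants1).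
Qed.

Variables (V : finType) (tv : {action gT &-> V}) (e : V -> A).
Hypotheses (e_orth : forall v w, e v * e w = if v == w then e v else 0)
  (e_sum : \sum_v e v = 1) (e_act : forall v g, to (e v) g = e (tv v g))
  (tv_free : forall g v, tv v g = v -> g = 1%g).

(** Only g = 1 contributes to e_v tr(e_v a) = sum_g e_v e_(g v) g(a), because
    g v <> v for the others. *)
Lemma trace_recoverl v a : e v * vsval (trace (e v * a)) = e v * a.
Proof.
rewrite traceE mulr_sumr (bigD1 1%g) //= total_act1 mulrA e_orth eqxx.
rewrite big1 ?addr0 // => g g1; rewrite act_mul e_act mulrA e_orth.
by case: eqP => [/esym/tv_free/eqP|]; rewrite ?(negbTE g1) ?mul0r.
Qed.

Lemma trace_recoverr v a : vsval (trace (a * e v)) * e v = a * e v.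
Proof.
rewrite traceE mulr_suml (bigD1 1%g) //= total_act1 -mulrA e_orth eqxx.
rewrite big1 ?addr0 // => g g1; rewrite act_mul e_act -mulrA e_orth.
by case: eqP => [/tv_free/eqP|]; rewrite ?(negbTE g1) ?mulr0.
Qed.

Lemma trace_dual_bases :
  dual_bases
    (frobenius_pairing invariants1 trace_linear trace_lact trace_ract) e e.
Proof.
split=> x.
  under eq_bigr => v _ do rewrite /= sub_lactE trace_recoverr.
  by rewrite -mulr_sumr e_sum mulr1.
under eq_bigr => v _ do rewrite /= sub_ractE trace_recoverl.
by rewrite -mulr_suml e_sum mul1r.
Qed.

Lemma idempotents_sum : \sum_v e v * e v = 1.
Proof. by rewrite -e_sum; apply: eq_bigr => v _; rewrite e_orth eqxx. Qed.

End Trace.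

(** * Quivers with a free action *)

(** The idempotents are the images of the trivial paths, which are orthogonal
    and sum to 1 already in the path algebra. *)
Lemma free_quiver_action_idempotents (k : fieldType) (gT : finGroupType)
    (A : falgType k) (to : alg_action gT A) :
    basic_with_free_quiver_action to ->
  exists (V : finType) (tv : {action gT &-> V}) (e : V -> A),
    [/\ forall v w, e v * e w = if v == w then e v else 0,
        \sum_v e v = 1,
        forall v g, to (e v) g = e (tv v g) &
        forall g v, tv v g = v -> g = 1%g].
Proof.
case=> Q [pi [tv [_ [[[pi1 piM] _ _] _ pi_act _ tv_free]]]].
exists (vertex Q), tv, (fun v => pi (pa_vertex k v)); split=> //.
- move=> v w; rewrite -piM; have -> : pa_vertex k v * pa_vertex k w
      = if v == w then pa_vertex k v else 0.
    rewrite [LHS]pa_mul_path /pa_cat; case: eqP => [<-|/eqP vw].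
      by have /qcatE -> // : qend (qtriv v) = qstart (qtriv v) /\
        val (qtriv v) = ((val (qtriv v)).1,
                         (val (qtriv v)).2 ++ (val (qtriv v)).2).
    by rewrite /qcat /qend /= (negbTE vw).
  by case: eqP; rewrite ?linear0.
- by rewrite -pi1 -linear_sum.
Qed.

Theorem theorem11 (k : fieldType) (A : falgType k) (gT : finGroupType)
    (to : alg_action gT A) (abelG : abelian [set: gT]) :
  [/\ (forall p, p \in [pchar k] -> ~~ (p %| #|gT|)%N) ->
        J_le A (invariant_algebra to),
      basic_with_free_quiver_action to ->
        J_le (invariant_algebra to) A &
      basic_with_free_quiver_action to ->
      (forall p, p \in [pchar k] -> ~~ (p %| #|gT|)%N) ->
      symmetric_algebra (invariant_algebra to) ->
      (exists g : gT, bimod_iso (dual_bimod A) (twisted_bimod to g)) ->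
        symm_separably_equivalent A (invariant_algebra to)].
Proof.
split=> [charG|/free_quiver_action_idempotents|/free_quiver_action_idempotents].
- exists (res_bimod (invariants1 to)), (ind_bimod (invariants1 to)).
  exact: invariants_summand.
- case=> V [tv [e [e_orth e_sum e_act tv_free]]].
  exists (ind_bimod (invariants1 to)), (res_bimod (invariants1 to)).
  apply: (separable_summand (trace_dual_bases e_orth e_sum e_act tv_free)).
  exact: idempotents_sum.
case=> V [tv [e [e_orth e_sum e_act tv_free]]] charG _ _.
apply: (frobenius_symm_separable
          (trace_dual_bases e_orth e_sum e_act tv_free)).
  exact: idempotents_sum.
exact: invariants_summand.
Qed.
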